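(* For every natural number $n\geq 1$ and every $1\leq i\leq n$, the logic $\Lambda^*_{n+1,i}$ is algebraizable in the sense of Blok and Pigozzi.
   Context: For $n\ge 1$ let $L_{n+1}=\{0,1/n,\ldots,(n-1)/n,1\}$ and let $\mathbf{L}^*_{n+1}=(L_{n+1},\vee,*,\neg,0,1)$ with $x\vee y=\max\{x,y\}$, $*x=\max\{0,2x-1\}$, $\neg x=1-x$. For $1\le i\le n$ let $F_{i/n}=\{a\in L_{n+1}: a\geq i/n\}$. The logic $\Lambda^*_{n+1,i}=\langle \mathbf{L}^*_{n+1},F_{i/n}\rangle$ is the matrix logic over the propositional language with connectives $(\vee,*,\neg,\bot)$ of arities $(2,1,1,0)$ ($\bot$ being interpreted as $0$) defined by: for every set of formulas $\Gamma\cup\{\varphi\}$, $\Gamma\models_{\Lambda^*_{n+1,i}}\varphi$ iff for every $\mathbf{L}^*_{n+1}$-evaluation $e$ (homomorphism from the formula algebra to $\mathbf{L}^*_{n+1}$), if $e(\psi)\geq i/n$ for every $\psi\in\Gamma$ then $e(\varphi)\geq i/n$. Algebraizable in the sense of Blok–Pigozzi may be taken in the following intrinsic form: there are a finite set $\Theta(p,q)$ of formulas in two variables and finitely many pairs of formulas $(\delta(p),\epsilon(p))$ in one variable such that, writing $\models$ for the consequence relation, $\models\Theta(\varphi,\varphi)$; $\Theta(\varphi,\psi)\models\Theta(\psi,\varphi)$; $\Theta(\varphi,\psi),\Theta(\psi,\chi)\models\Theta(\varphi,\chi)$; $\Theta$ is compatible with every connective (e.g. $\Theta(\varphi,\psi)\models\Theta(\#\varphi,\#\psi)$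 for $\#\in\{\neg,*\}$ and $\Theta(\varphi,\psi),\Theta(\chi,\nu)\models\Theta(\varphi\vee\chi,\psi\vee\nu)$); and $\varphi$ is interderivable with the set of all formulas in $\Theta(\delta(\varphi),\epsilon(\varphi))$. *)

(* Defs.v *)
From mathcomp Require Import all_boot all_order all_algebra.
From mathcomp Require Import boolp classical_sets cardinality.
Set Implicit Arguments.
Unset Strict Implicit.
Unset Printing Implicit Defensive.
Import Order.TTheory GRing.Theory Num.Theory.
Local Open Scope classical_set_scope.
Local Open Scope ring_scope.

Record algebra := Algebra {
  carrier :> Type;
  op_or : carrier -> carrier -> carrier;
  op_star : carrier -> carrier;
  op_neg : carrier -> carrier;
  op_bot : carrier
}.

Arguments op_or {a} _ _.
Arguments op_star {a} _.
Arguments op_neg {a} _.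
Arguments op_bot {a}.

Definition is_hom (A B : algebra) (f : A -> B) : Prop :=
  [/\ forall x y, f (op_or x y) = op_or (f x) (f y),
      forall x, f (op_star x) = op_star (f x),
      forall x, f (op_neg x) = op_neg (f x)
    & f op_bot = op_bot].

Inductive form (X : Type) : Type :=
| Var of X
| Or of form X & form X
| Star of form X
| Neg of form X
| Bot.

Arguments Bot {X}.

Definition form_algebra (X : Type) : algebra :=
  Algebra (@Or X) (@Star X) (@Neg X) Bot.

(* The formulas of the logics; [form bool] and [form unit] serve as the
   formulas in two variables and in one variable, respectively. *)
Definition formula := form nat.

Fixpoint subst (X Y : Type) (s : X -> form Y) (a : form X) : form Y :=
  match a with
  | Var x => s x
  | Or b c => Or (subst s b) (subst s c)
  | Star b => Star (subst s b)
  | Neg b => Neg (subst s b)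
  | Bot => Bot
  end.

(* The variable [true] plays the role of p and [false] that of q. *)
Definition inst2 (t : form bool) (a b : formula) : formula :=
  subst (fun x : bool => if x then a else b) t.

Definition inst1 (d : form unit) (a : formula) : formula :=
  subst (fun _ : unit => a) d.

Definition consequence := set formula -> formula -> Prop.

Definition matrix_consequence (A : algebra) (F : set A) : consequence :=
  fun Gamma phi =>
    forall e : formula -> A, is_hom (A := form_algebra nat) e ->
      (forall psi, Gamma psi -> F (e psi)) -> F (e phi).

Definition entails (C : consequence) (Gamma Delta : set formula) : Prop :=
  forall phi, Delta phi -> C Gamma phi.

Definition inst2_set (Theta : set (form bool)) (a b : formula) : set formula :=
  [set inst2 t a b | t in Theta].

Definition algebraizable (C : consequence) : Prop :=
  exists (Theta : set (form bool)) (DE : set (form unit * form unit)),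
  let T := inst2_set Theta in
  let TDE phi := \bigcup_(de in DE) T (inst1 de.1 phi) (inst1 de.2 phi) in
  [/\ finite_set Theta /\ finite_set DE,
      [/\ forall phi, entails C set0 (T phi phi),
          forall phi psi, entails C (T phi psi) (T psi phi)
        & forall phi psi chi,
            entails C (T phi psi `|` T psi chi) (T phi chi)],
      [/\ forall phi psi chi nu,
            entails C (T phi psi `|` T chi nu) (T (Or phi chi) (Or psi nu)),
          forall phi psi, entails C (T phi psi) (T (Star phi) (Star psi)),
          forall phi psi, entails C (T phi psi) (T (Neg phi) (Neg psi))
        & entails C set0 (T Bot Bot)]
    & forall phi,
        entails C [set phi] (TDE phi) /\ entails C (TDE phi) [set phi]].

(* The chain with n + 1 elements k / n; meaningful for n >= 1 only. *)
Definition in_chain (n : nat) (x : rat) : Prop :=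
  exists2 k : nat, (k <= n)%N & x = k%:R / n%:R.

Definition chain (n : nat) : Type := {x : rat | in_chain n x}.

Lemma in_chain_max n x y :
  in_chain n x -> in_chain n y -> in_chain n (Num.max x y).
Proof. by move=> hx hy; rewrite /Num.max; case: ifP. Qed.

Lemma in_chain_star n (hn : (1 <= n)%N) x :
  in_chain n x -> in_chain n (Num.max 0 (2 * x - 1)).
Proof.
case=> k kn ->; have n0 : n%:R != 0 :> rat by rewrite pnatr_eq0 -lt0n.
have -> : 2 * (k%:R / n%:R) - 1 = ((k.*2)%:R - n%:R) / n%:R :> rat.
  by rewrite mulrBl divff // -muln2 natrM mulrAC [2 * _]mulrC mulrAC.
have [nk|kn'] := leqP n k.*2.
  rewrite -natrB // max_r ?divr_ge0 ?ler0n //.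
  exists (k.*2 - n)%N => //.
  by rewrite leq_subLR addnn leq_double.
rewrite max_l; first by exists 0%N => //; rewrite mul0r.
by rewrite mulr_le0_ge0 ?invr_ge0 ?ler0n // subr_le0 ler_nat ltnW.
Qed.

Lemma in_chain_neg n (hn : (1 <= n)%N) x : in_chain n x -> in_chain n (1 - x).
Proof.
case=> k kn ->; exists (n - k)%N; first exact: leq_subr.
by rewrite natrB // mulrBl divff // pnatr_eq0 -lt0n.
Qed.

Lemma in_chain0 n : in_chain n 0.
Proof. by exists 0%N => //; rewrite mul0r. Qed.

Definition chain_or n (x y : chain n) : chain n :=
  exist _ (Num.max (sval x) (sval y)) (in_chain_max (svalP x) (svalP y)).

Definition chain_star n (hn : (1 <= n)%N) (x : chain n) : chain n :=
  exist _ (Num.max 0 (2 * sval x - 1)) (in_chain_star hn (svalP x)).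

Definition chain_neg n (hn : (1 <= n)%N) (x : chain n) : chain n :=
  exist _ (1 - sval x) (in_chain_neg hn (svalP x)).

Definition chain_bot n : chain n := exist _ 0 (in_chain0 n).

Definition Lstar {n} (hn : (1 <= n)%N) : algebra :=
  Algebra (@chain_or n) (chain_star hn) (chain_neg hn) (chain_bot n).

Definition chain_filter {n} (hn : (1 <= n)%N) (i : nat) : set (Lstar hn) :=
  [set a : Lstar hn | i%:R / n%:R <= sval a].

Arguments chain_filter {n} hn i _.

Definition Lambda_star {n} (hn : (1 <= n)%N) (i : nat) : consequence :=
  matrix_consequence (chain_filter hn i).

Arguments Lambda_star {n} hn i _ _.

(* Main.v *)
Require Import Defs.
From mathcomp Require Import all_boot all_order all_algebra.
From mathcomp Require Import boolp classical_sets cardinality lra.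
(* After the linear algebra files, [form] denotes sesquilinear forms; this makes it
   the type of formulas again. *)
Import Defs.

(** A matrix logic is algebraizable as soon as the matrix can express equality:
    if finitely many binary terms are all designated at [(a, b)] exactly when
    [a = b], they behave as an equality predicate, hence as a congruence
    ([algebraizable_of_equality]).

    In the chain with [n + 1] elements equality is expressible because every
    step function [x |-> (k/n <= x)], [1 <= k <= n], is a term.  The reason is
    that [*] doubles distances on [[1/2, 1]] and collapses [[0, 1/2]] to [0],
    whereas [~*~], which is [x |-> min 1 (2 x)], doubles distances on
    [[0, 1/2]] and collapses [[1/2, 1]] to [1].  Composing these two monotone
    maps drives any pair [x < y] apart until it reaches [(0, 1)]
    ([separating_term]).  For the consecutive elements [x = (k-1)/n] and
    [y = k/n], monotonicity leaves no other values than [0] below and [1] above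
    ([step_term]).

    Step functions take the values [0] and [1] only, of which exactly [1] is
    designated, and on these values [\/] and [~] are Boolean.  So the
    equivalences of the step functions at [p] and at [q], for all [k], form the
    set [Theta]; and since the designated elements are those where the step
    function at [i/n] is [1], that step term and [~bot] give the defining
    equation. *)

Set Implicit Arguments.
Unset Strict Implicit.
Unset Printing Implicit Defensive.
Import Order.TTheory GRing.Theory Num.Theory.
Local Open Scope classical_set_scope.
Local Open Scope ring_scope.

(** * Evaluation of terms *)

Fixpoint eval (A : algebra) (X : Type) (v : X -> A) (t : form X) : A :=
  match t with
  | Var x => v x
  | Or a b => op_or (eval v a) (eval v b)
  | Star a => op_star (eval v a)
  | Neg a => op_neg (eval v a)
  | Bot => op_bot
  end.

Lemma hom_eval (A B : algebra) (f : A -> B) (X : Type) (v : X -> A)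
    (t : form X) :
  is_hom f -> f (eval v t) = eval (f \o v) t.
Proof.
case=> f_or f_star f_neg f_bot.
by elim: t => //= [a IHa b IHb|a IHa|a IHa];
  rewrite ?f_or ?f_star ?f_neg ?IHa ?IHb.
Qed.

Lemma subst_eval (X Y : Type) (s : X -> form Y) (t : form X) :
  subst s t = eval (A := form_algebra Y) s t.
Proof. by elim: t => //= [a -> b ->|a ->|a ->]. Qed.

Lemma hom_subst (A : algebra) (X Y : Type) (e : form Y -> A)
    (s : X -> form Y) (t : form X) :
  is_hom (A := form_algebra Y) e -> e (subst s t) = eval (e \o s) t.
Proof. by move=> he; rewrite subst_eval (hom_eval _ _ he). Qed.

Lemma eval_is_hom (A : algebra) (X : Type) (v : X -> A) :
  is_hom (A := form_algebra X) (eval v).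
Proof. by []. Qed.

Lemma eval_subst (A : algebra) (X Y : Type) (v : Y -> A) (s : X -> form Y)
    (t : form X) :
  eval v (subst s t) = eval (eval v \o s) t.
Proof. exact/hom_subst/eval_is_hom. Qed.

(** * Matrices with definable equality *)

(** Under an evaluation, each condition on [Theta] becomes a property of
    equality in [A]: an equivalence relation compatible with the operations. *)
Lemma algebraizable_of_equality (A : algebra) (F : set A)
    (Theta : set (form bool)) (d eps : form unit) :
  finite_set Theta ->
  (forall v : bool -> A,
     (forall t, Theta t -> F (eval v t)) <-> v true = v false) ->
  (forall a : A, F a <-> eval (fun=> a) d = eval (fun=> a) eps) ->
  algebraizable (matrix_consequence F).
Proof.
move=> fin ThetaP FP; exists Theta, [set (d, eps)].
set T := inst2_set Theta; move=> TDE.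
have TP (e : formula -> A) phi psi : is_hom (A := form_algebra nat) e ->
    (forall t, T phi psi t -> F (e t)) <-> e phi = e psi.
  move=> he; rewrite -(ThetaP (fun b => if b then e phi else e psi)).
  have inst t : e (inst2 t phi psi) =
      eval (fun b : bool => if b then e phi else e psi) t.
    by rewrite /inst2 hom_subst //; congr eval; apply/funext => -[].
  by split=> [h t Tt|h _ [t Tt <-]]; [rewrite -inst; apply: h; exists t|
    rewrite inst; exact: h].
have inst (e : formula -> A) phi (u : form unit) :
    is_hom (A := form_algebra nat) e ->
    e (inst1 u phi) = eval (fun=> e phi) u.
  by move=> he; rewrite /inst1 hom_subst.
split; first by split=> //; exact: finite_set1.
- split.
  + by move=> phi t Tt e he _; apply: (TP e phi phi he).2 Tt.
  + move=> phi psi t Tt e he /(TP e _ _ he) eq.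
    by apply: (TP e psi phi he).2 Tt.
  + move=> phi psi chi t Tt e he h; apply: (TP e phi chi he).2 Tt.
    rewrite ((TP e phi psi he).1) => [|u Tu]; last by apply: h; left.
    by apply/(TP e _ _ he) => u Tu; apply: h; right.
- split.
  + move=> phi psi chi nu t Tt e he h; apply: (TP e _ _ he).2 Tt.
    have [e_or _ _ _] := he; rewrite !e_or /=.
    rewrite ((TP e phi psi he).1) => [|u Tu]; last by apply: h; left.
    by rewrite ((TP e chi nu he).1) => [//|u Tu]; apply: h; right.
  + move=> phi psi t Tt e he /(TP e _ _ he) eq; apply: (TP e _ _ he).2 Tt.
    by have [_ e_star _ _] := he; rewrite !e_star /= eq.
  + move=> phi psi t Tt e he /(TP e _ _ he) eq; apply: (TP e _ _ he).2 Tt.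
    by have [_ _ e_neg _] := he; rewrite !e_neg /= eq.
  + by move=> t Tt e he _; apply: (TP e _ _ he).2 Tt.
- move=> phi; split=> [t [_ -> /= Tt] e he h|_ -> e he h].
    apply: (TP e _ _ he).2 Tt; rewrite !inst //.
    by apply/FP; apply: h.
  apply/FP; rewrite -!inst //; apply/(TP e _ _ he) => t Tt.
  by apply: h; exists (d, eps).
Qed.

(** * Separation of points by monotone terms *)

(** All the chains embed in this algebra, where the estimates below need no
    reference to [n]. *)
Definition rat_star : algebra :=
  @Algebra rat Num.max (fun x => Num.max 0 (2 * x - 1)) (fun x => 1 - x) 0.

Definition ueval (t : form unit) (x : rat) : rat :=
  eval (A := rat_star) (fun=> x) t.

Definition comp_term (t u : form unit) : form unit := subst (fun=> u) t.

(** In the unit interval these are the two branches of doubling: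
    [x |-> 2 x - 1] truncated at [0], and [x |-> 2 x] truncated at [1]. *)
Definition double_up : form unit := Star (Var tt).
Definition double_down : form unit := Neg (Star (Neg (Var tt))).

Lemma ueval_comp t u x : ueval (comp_term t u) x = ueval t (ueval u x).
Proof. by rewrite /ueval /comp_term eval_subst. Qed.

Lemma double_upE x : ueval double_up x = Num.max 0 (2 * x - 1).
Proof. by []. Qed.

Lemma double_downE x : ueval double_down x = Num.min 1 (2 * x).
Proof.
rewrite /ueval /= /Num.max /Num.min.
by case: ifP; case: ifP; lra.
Qed.

Definition separates (t : form unit) (x y : rat) : Prop :=
  [/\ {homo ueval t : u v / u <= v}, ueval t x = 0 & ueval t y = 1].

Lemma separates_up t x y :
  separates t (ueval double_up x) (ueval double_up y) ->
  separates (comp_term t double_up) x y.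
Proof.
case=> mono tx ty; split; rewrite ?ueval_comp // => u v uv.
rewrite !ueval_comp; apply: mono; rewrite !double_upE /Num.max.
by case: ifP; case: ifP; lra.
Qed.

Lemma separates_down t x y :
  separates t (ueval double_down x) (ueval double_down y) ->
  separates (comp_term t double_down) x y.
Proof.
case=> mono tx ty; split; rewrite ?ueval_comp // => u v uv.
rewrite !ueval_comp; apply: mono; rewrite !double_downE /Num.min.
by case: ifP; case: ifP; lra.
Qed.

(** A threshold in terms of powers of [2] serves as induction measure: each
    doubling of the distance [d] lowers the exponent [m] by one. *)
Lemma pow2_bound (d : rat) : 0 < d -> exists m, 1 <= 2 ^+ m * d.
Proof.
move=> d0; exists (Num.bound d^-1).
rewrite -ler_pdivrMr // mul1r; apply/ltW.
exact: (upper_nthrootP (leqnn _)).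
Qed.

(** Iterating [*] fixes [1] and sends any smaller element to [0], as it doubles
    the distance to [1]. *)
Lemma separating_term_top (x : rat) :
  0 <= x < 1 -> exists t, separates t x 1.
Proof.
move=> /andP[x0 x1].
have [m] : exists m, 1 <= 2 ^+ m * (1 - x) by apply: pow2_bound; lra.
elim: m x x0 x1 => [|m IH] x x0 x1 hm.
  by exists (Var tt); split=> //; rewrite /ueval /=; move: hm; lra.
have up1 : ueval double_up 1 = 1 by rewrite double_upE max_r; lra.
have [x2|x2] := leP (1 / 2) x; last first.
  exists (comp_term (Var tt) double_up); apply: separates_up.
  have -> : ueval double_up x = 0 by rewrite double_upE max_l; lra.
  by rewrite up1; split.
have upx : ueval double_up x = 2 * x - 1 by rewrite double_upE max_r; lra.
have [|||t ht] := IH (2 * x - 1); first by lra.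
- by lra.
- by move: hm; rewrite exprSr; lra.
by exists (comp_term t double_up); apply: separates_up; rewrite up1 upx.
Qed.

(** As long as [x] and [y] lie in the same half of the unit interval, one of the
    two doubling maps doubles their distance; so at some point they lie on both
    sides of [1/2], and [~*~] sends the upper one to [1]
    while keeping the lower one below [1]. *)
Lemma separating_term (x y : rat) :
  0 <= x -> x < y -> y <= 1 -> exists t, separates t x y.
Proof.
move=> x0 xy y1.
have [m] : exists m, 1 <= 2 ^+ m * (y - x) by apply: pow2_bound; lra.
elim: m x y x0 xy y1 => [|m IH] x y x0 xy y1 hm.
  by exists (Var tt); split=> //; rewrite /ueval /=; move: hm; lra.
have [x2|x2] := leP (1 / 2) x.
  have [||||t ht] := IH (2 * x - 1) (2 * y - 1); try lra.
    by move: hm; rewrite exprSr; lra.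
  exists (comp_term t double_up); apply: separates_up.
  by rewrite !double_upE !max_r //; lra.
have downx : ueval double_down x = 2 * x by rewrite double_downE min_r; lra.
have [y2|y2] := leP y (1 / 2).
  have [||||t ht] := IH (2 * x) (2 * y); try lra.
    by move: hm; rewrite exprSr; lra.
  exists (comp_term t double_down); apply: separates_down.
  by rewrite downx double_downE min_r //; lra.
have [|t ht] := @separating_term_top (2 * x); first by lra.
exists (comp_term t double_down); apply: separates_down.
by rewrite downx double_downE min_l //; lra.
Qed.

(** * Step functions on the chain *)

Lemma sval_is_hom n (hn : (1 <= n)%N) :
  is_hom (A := Lstar hn) (B := rat_star) sval.
Proof. by []. Qed.

Lemma sval_eval n (hn : (1 <= n)%N) (x : Lstar hn) (t : form unit) :
  sval (eval (fun=> x) t) = ueval t (sval x).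
Proof. exact: (hom_eval _ _ (sval_is_hom hn)). Qed.

Lemma chain_bounds n (hn : (1 <= n)%N) (x : chain n) : 0 <= sval x <= 1.
Proof.
have n0 : 0 < n%:R :> rat by rewrite ltr0n.
case: x => _ /= [k kn ->].
by rewrite divr_ge0 ?ler0n // ler_pdivrMr // mul1r ler_nat.
Qed.

Lemma chain_inj n (x y : chain n) : sval x = sval y -> x = y.
Proof.
case: x y => [x hx] [y hy] /= xy; subst y; congr exist.
exact: Prop_irrelevance.
Qed.

(** The two consecutive elements that a threshold separates leave no room: the
    separating term is [<= 0] below it and [>= 1] from it on, and its values
    stay in the unit interval. *)
Lemma step_term n (hn : (1 <= n)%N) (k : nat) : (k < n)%N ->
  exists t : form unit, forall x : Lstar hn,
    sval (eval (fun=> x) t) = (k.+1%:R / n%:R <= sval x)%R%:R.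
Proof.
move=> kn; have n0 : 0 < n%:R :> rat by rewrite ltr0n.
have [|||t [mono t0 t1]] :=
    @separating_term (k%:R / n%:R) (k.+1%:R / n%:R).
- by rewrite divr_ge0 ?ler0n.
- by rewrite ltr_pM2r ?invr_gt0 // ltr_nat.
- by rewrite ler_pdivrMr // mul1r ler_nat.
exists t => x; have /andP[tx0 tx1] := chain_bounds hn (eval (fun=> x) t).
move: tx0 tx1; rewrite sval_eval; case: x => _ /= [j jn ->] tx0 tx1.
rewrite ler_pM2r ?invr_gt0 // ler_nat.
apply/eqP; rewrite eq_le; case: (ltnP k j) => jk.
  by rewrite tx1 /= -[leLHS]t1 mono // ler_pM2r ?invr_gt0 // ler_nat.
by rewrite tx0 andbT /= -[leRHS]t0 mono // ler_pM2r ?invr_gt0 // ler_nat.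
Qed.

Lemma chain_eq_steps n (hn : (1 <= n)%N) (x y : chain n) :
  (forall k, (k < n)%N ->
     (k.+1%:R / n%:R <= sval x) = (k.+1%:R / n%:R <= sval y)) ->
  x = y.
Proof.
have n0 : 0 < n%:R :> rat by rewrite ltr0n.
move=> h; apply: chain_inj.
move: (svalP x) (svalP y) h => [j jn ->] [l ln ->] h.
have {}h k : (k < n)%N -> (k < j)%N = (k < l)%N.
  by move=> /h; rewrite !ler_pM2r ?invr_gt0 // !ler_nat.
congr (_%:R / _); apply/eqP; rewrite eqn_leq; apply/andP; split.
  by case: j jn h => // j jn h; rewrite -h.
by case: l ln h => // l ln h; rewrite h.
Qed.

(** * Equality on the chain *)

Definition Iff (X : Type) (a b : form X) : form X :=
  Or (Neg (Or a b)) (Neg (Or (Neg a) (Neg b))).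

Lemma sval_eval_Iff n (hn : (1 <= n)%N) X (v : X -> Lstar hn) (a b : form X)
    (p q : bool) :
  sval (eval v a) = p%:R -> sval (eval v b) = q%:R ->
  sval (eval v (Iff a b)) = (p == q)%:R.
Proof.
by move=> /= -> ->; case: p; case: q.
Qed.

Theorem theorem4p3 (n : nat) (hn : (1 <= n)%N) (i : nat) (hi : (1 <= i <= n)%N) :
  algebraizable (Lambda_star hn i).
Proof.
have n0 : 0 < n%:R :> rat by rewrite ltr0n.
have [s sP] : exists s : nat -> form unit, forall k, (k < n)%N ->
    forall x : Lstar hn,
    sval (eval (fun=> x) (s k)) = (k.+1%:R / n%:R <= sval x)%R%:R.
  suff /choice[s sP] : forall k, exists t : form unit, (k < n)%N ->
      forall x : Lstar hn,
      sval (eval (fun=> x) t) = (k.+1%:R / n%:R <= sval x)%R%:R by exists s.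
  move=> k.
  have [kn|_] := ltnP k n; last by exists Bot.
  by have [t tP] := step_term hn kn; exists t.
(* As [0 < i <= n], the designated elements include [1] but not [0]. *)
have des01 (x : Lstar hn) (b : bool) : sval x = b%:R ->
    chain_filter hn i x <-> b.
  move: hi => /andP[i1 ilen]; rewrite /chain_filter /= => ->.
  case: b; rewrite /= ler_pdivrMr //.
    by rewrite mul1r ler_nat; split.
  by rewrite mul0r lern0 eqn0Ngt i1.
pose th k : form bool :=
  Iff (subst (fun=> Var true) (s k)) (subst (fun=> Var false) (s k)).
have thP (v : bool -> Lstar hn) k : (k < n)%N ->
    chain_filter hn i (eval v (th k)) <->
    (k.+1%:R / n%:R <= sval (v true)) = (k.+1%:R / n%:R <= sval (v false)).
  move=> kn; rewrite (rwP eqP); apply: des01.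
  by apply: sval_eval_Iff; rewrite eval_subst; exact: sP.
(* Index [k] stands for the threshold [(k+1)/n], hence [i.-1] for [i/n]. *)
apply: (@algebraizable_of_equality _ _ (th @` `I_n) (s i.-1) (Neg Bot)).
- exact/finite_image/finite_II.
- move=> v; split=> [h|eq _ [k kn <-]]; last by apply/thP => //; rewrite eq.
  by apply: (chain_eq_steps hn) => k kn; apply/thP => //; apply: h; exists k.
- move=> a.
  have sa : sval (eval (fun=> a) (s i.-1)) = (i%:R / n%:R <= sval a)%R%:R.
    by case: i hi {des01 thP} => // j jn; exact: sP.
  have s1 : sval (eval (fun=> a) (Neg (@Bot unit))) = 1 by rewrite /= subr0.
  rewrite /chain_filter /=; split=> [ia|a1].
    by apply: chain_inj; rewrite sa [RHS]s1 ia.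
  by have := sa; rewrite a1 [LHS]s1; case: (_ <= _).
Qed.
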